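(* Let $m$ be a positive integer, $\Omega=\{(i,j):1\le i,j\le m\}$, let $f\in\mathbb{R}^{m^2}$ be a given image on $\Omega$, and let $\lambda>0$, $\alpha>0$, $h>0$. Let $g$ be one of the three functions $g_1(\kappa)=1+\alpha|\kappa|$, $g_2(\kappa)=1+\alpha|\kappa^2|$, $g_3(\kappa)=\sqrt{1+\alpha|\kappa^2|}$, and let $\kappa=\kappa(u)$ be either the discrete mean curvature $H(u)$ or the discrete Gaussian curvature $K(u)$ of $u$ (defined in the context). Then there exists a minimizer $u^*\in\mathbb{R}^{m^2}$ of the discrete minimization problem $$\min_{u\in\mathbb{R}^{m^2}}\ \sum_{1\le i,j\le m} g(\kappa_{i,j}(u))\,|(\nabla u)_{i,j}|+\frac{\lambda}{2}\|u-f\|^2 .$$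
   Context: Images are functions $u=(u_{i,j})_{1\le i,j\le m}\in\mathbb{R}^{m^2}$. Indices outside $\{1,\dots,m\}$ are understood periodically (mod $m$). $|\cdot|$ is the Euclidean norm on $\mathbb{R}^2$ (absolute value on $\mathbb{R}$) and $\|u\|^2=\sum_{i,j}u_{i,j}^2$. Discrete gradient: $(\nabla u)_{i,j}=(u_{i+1,j}-u_{i,j},\ u_{i,j+1}-u_{i,j})\in\mathbb{R}^2$, with periodic extension (so $u_{m+1,j}=u_{1,j}$, $u_{i,m+1}=u_{i,1}$). Discrete curvatures: for each pixel $(i,j)$ define $$d_1=\frac{2u_{i,j}-u_{i,j-1}-u_{i,j+1}}{\sqrt{(2u_{i-1,j}-u_{i,j-1}-u_{i,j+1})^2+(u_{i,j-1}-u_{i,j+1})^2+4}},$$ $$d_2=\frac{u_{i,j-1}+u_{i,j+1}-2u_{i,j}}{\sqrt{(2u_{i+1,j}-u_{i,j-1}-u_{i,j+1})^2+(u_{i,j+1}-u_{i,j-1})^2+4}},$$ $$d_3=\frac{u_{i-1,j}+u_{i+1,j}-2u_{i,j}}{\sqrt{(u_{i+1,j}-u_{i-1,j})^2+(u_{i-1,j}+u_{i+1,j}-2u_{i,j-1})^2+4}},$$ $$d_4=\frac{2u_{i,j}-u_{i-1,j}-u_{i+1,j}}{\sqrt{(u_{i-1,j}-u_{i+1,j})^2+(u_{i-1,j}+u_{i+1,j}-2u_{i,j+1})^2+4}},$$ $$d_5=\frac{u_{i-1,j+1}+u_{i+1,j-1}-2u_{i,j}}{\sqrt{(u_{i+1,j-1}-u_{i-1,j-1})^2+(u_{i-1,j+1}-u_{i-1,j-1})^2+4}},$$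 $$d_6=\frac{2u_{i,j}-u_{i-1,j+1}-u_{i+1,j-1}}{\sqrt{(u_{i-1,j+1}-u_{i+1,j+1})^2+(u_{i+1,j-1}-u_{i+1,j+1})^2+4}},$$ $$d_7=\frac{2u_{i,j}-u_{i-1,j-1}-u_{i+1,j+1}}{\sqrt{(u_{i-1,j+1}-u_{i+1,j+1})^2+(u_{i-1,j-1}-u_{i-1,j+1})^2+4}},$$ $$d_8=\frac{u_{i-1,j-1}+u_{i+1,j+1}-2u_{i,j}}{\sqrt{(u_{i+1,j-1}-u_{i-1,j-1})^2+(u_{i+1,j+1}-u_{i+1,j-1})^2+4}}.$$ Let $u_{(1)}=u_{i-1,j}$, $u_{(2)}=u_{i+1,j}$, $u_{(3)}=u_{i,j-1}$, $u_{(4)}=u_{i,j+1}$, $u_{(5)}=u_{i-1,j-1}$, $u_{(6)}=u_{i+1,j+1}$, $u_{(7)}=u_{i-1,j+1}$, $u_{(8)}=u_{i+1,j-1}$. The eight discrete normal curvatures at $(i,j)$ are $$k_\ell=\frac{2d_\ell}{(u_{(\ell)}-u_{i,j})^2+h^2}\ (\ell=1,2,3,4),\qquad k_\ell=\frac{2d_\ell}{(u_{(\ell)}-u_{i,j})^2+2h^2}\ (\ell=5,6,7,8).$$ The discrete principal curvatures are $\kappa_1=\max_{1\le\ell\le 8}k_\ell$ and $\kappa_2=\min_{1\le\ell\le 8}k_\ell$; the discrete mean and Gaussian curvatures at $(i,j)$ are $H_{i,j}(u)=(\kappa_1+\kappa_2)/2$ and $K_{i,j}(u)=\kappa_1\kappa_2$.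 *)

(* Defs.v *)
From mathcomp Require Import all_boot all_order all_algebra.
From mathcomp Require Import reals.

Set Implicit Arguments.
Unset Strict Implicit.
Unset Printing Implicit Defensive.

Import Order.TTheory GRing.Theory Num.Theory.
Local Open Scope ring_scope.

Section Images.
Variables (R : realType) (m : nat).

(* An image is a square matrix; [ordS] and [ord_pred] are the successor and
   predecessor modulo m on 'I_m, i.e. the periodic extension of the indices. *)
Implicit Types (u f : 'M[R]_m) (i j : 'I_m).

Definition normsq u : R := \sum_i \sum_j u i j ^+ 2.

Definition grad u i j : R * R :=
  (u (ordS i) j - u i j, u i (ordS j) - u i j).

Definition enorm (v : R * R) : R := Num.sqrt (v.1 ^+ 2 + v.2 ^+ 2).

(* In [nbr], [sdist] and [ncurv], the index l ranges over 1, ..., 8; the values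
   at other l are never used. *)
Definition nbr u i j (l : nat) : R :=
  match l with
  | 1%N => u (ord_pred i) j
  | 2%N => u (ordS i) j
  | 3%N => u i (ord_pred j)
  | 4%N => u i (ordS j)
  | 5%N => u (ord_pred i) (ord_pred j)
  | 6%N => u (ordS i) (ordS j)
  | 7%N => u (ord_pred i) (ordS j)
  | 8%N => u (ordS i) (ord_pred j)
  | _ => 0
  end.

(* The letters n, s, w, e denote i-1, i+1, j-1, j+1 and c the centre (i, j). *)
Definition sdist u i j (l : nat) : R :=
  let c := u i j in
  let n := u (ord_pred i) j in
  let s := u (ordS i) j in
  let w := u i (ord_pred j) in
  let e := u i (ordS j) in
  let nw := u (ord_pred i) (ord_pred j) in
  let ne := u (ord_pred i) (ordS j) in
  let sw := u (ordS i) (ord_pred j) in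
  let se := u (ordS i) (ordS j) in
  match l with
  | 1%N => (2 * c - w - e) /
         Num.sqrt ((2 * n - w - e) ^+ 2 + (w - e) ^+ 2 + 4)
  | 2%N => (w + e - 2 * c) /
         Num.sqrt ((2 * s - w - e) ^+ 2 + (e - w) ^+ 2 + 4)
  | 3%N => (n + s - 2 * c) /
         Num.sqrt ((s - n) ^+ 2 + (n + s - 2 * w) ^+ 2 + 4)
  | 4%N => (2 * c - n - s) /
         Num.sqrt ((n - s) ^+ 2 + (n + s - 2 * e) ^+ 2 + 4)
  | 5%N => (ne + sw - 2 * c) /
         Num.sqrt ((sw - nw) ^+ 2 + (ne - nw) ^+ 2 + 4)
  | 6%N => (2 * c - ne - sw) /
         Num.sqrt ((ne - se) ^+ 2 + (sw - se) ^+ 2 + 4)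
  | 7%N => (2 * c - nw - se) /
         Num.sqrt ((ne - se) ^+ 2 + (nw - ne) ^+ 2 + 4)
  | 8%N => (nw + se - 2 * c) /
         Num.sqrt ((sw - nw) ^+ 2 + (se - sw) ^+ 2 + 4)
  | _ => 0
  end.

Definition ncurv (h : R) u i j (l : nat) : R :=
  2 * sdist u i j l /
  ((nbr u i j l - u i j) ^+ 2 + (if (l <= 4)%N then h ^+ 2 else 2 * h ^+ 2)).

(* The first curvature serves as the neutral element of the iterated max/min,
   which leaves the extremum over 1 <= l <= 8 unchanged. *)
Definition kappa1 (h : R) u i j : R :=
  \big[Num.max/ncurv h u i j 1]_(1 <= l < 9) ncurv h u i j l.

Definition kappa2 (h : R) u i j : R :=
  \big[Num.min/ncurv h u i j 1]_(1 <= l < 9) ncurv h u i j l.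

Definition mean_curv (h : R) u i j : R := (kappa1 h u i j + kappa2 h u i j) / 2.

Definition gauss_curv (h : R) u i j : R := kappa1 h u i j * kappa2 h u i j.

Definition energy (g : R -> R) (kappa : 'M[R]_m -> 'I_m -> 'I_m -> R)
    (lambda : R) f u : R :=
  (\sum_i \sum_j g (kappa u i j) * enorm (grad u i j))
  + lambda / 2 * normsq (u - f).

End Images.

Section Weights.
Variables (R : realType) (alpha : R).

Definition g1 (k : R) : R := 1 + alpha * `|k|.
Definition g2 (k : R) : R := 1 + alpha * `|k ^+ 2|.
Definition g3 (k : R) : R := Num.sqrt (1 + alpha * `|k ^+ 2|).

End Weights.

(* Main.v *)
Require Import Defs.
From mathcomp Require Import all_boot all_order all_algebra.
From mathcomp Require Import reals.
From mathcomp Require Import boolp classical_sets topology.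
From mathcomp Require Import normedtype derive realfun.

Import Order.TTheory GRing.Theory Num.Theory.
Import numFieldNormedType.Exports.
Local Open Scope ring_scope.

(** The functional is continuous and coercive on a finite-dimensional space, so
    a minimizer exists by the extreme value theorem.

    Continuity: no denominator in the discrete curvatures vanishes (those of
    the signed distances are at least 2, those of the normal curvatures at least
    [h ^+ 2 > 0]), so each normal curvature is continuous in [u]; finite maxima
    and minima, the mean and Gaussian curvatures, the three weights, the
    Euclidean norm and finite sums all preserve continuity ([continuous_ncurv],
    [continuous_kappa1], [continuous_kappa2], [continuous_energy]).

    Coercivity: the weights are nonnegative, so the fidelity term alone is a
    lower bound for the energy.  Hence [energy u <= energy f] confines every
    entry of [u] to an interval of fixed radius about the same entry of [f]
    ([energy_sublevel]), and the box so defined is compact ([mx_compact]).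
    Since [f] lies in the box and every image outside it has energy larger than
    that of [f], a minimizer over the box is a global one
    ([continuous_energy_minimizer]). *)

(** * Matrices as a topological space *)

(** Matrices carry the product topology of their entries. *)
Lemma continuous_mx (T U : topologicalType) (m n : nat) (F : T -> 'M[U]_(m, n)) :
  (forall i j, continuous (fun t => F t i j)) -> continuous F.
Proof.
move=> cF t A [P Pt PA]; suff : \forall s \near t, forall i j, P i j (F s i j).
  by apply: filterS => s; exact: PA.
apply: filter_forall => i; apply: filter_forall => j.
exact: cF (Pt i j).
Qed.

(** Tychonoff's theorem for matrices, transported from row vectors along the
    continuous bijection [vec_mx]. *)
Lemma mx_compact (T : ptopologicalType) (m n : nat)
    (A : 'I_m -> 'I_n -> set T) :
  (forall i j, compact (A i j)) ->
  compact [set M : 'M[T]_(m, n) | forall i j, A i j (M i j)].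
Proof.
move=> cA.
(* [B] is the family [A] re-indexed along [mxvec_index]. *)
pose B (k : 'I_(m * n)) : set T :=
  let ij := enum_val (cast_ord (esym (mxvec_cast m n)) k) in A ij.1 ij.2.
have BE i j : B (mxvec_index i j) = A i j.
  by rewrite /B /mxvec_index cast_ordK enum_rankK.
rewrite (_ : mkset _ = vec_mx @` [set v : 'rV[T]_(m * n) |
    forall k, B k (v ord0 k)])%classic.
  apply: continuous_compact.
    apply: continuous_subspaceT; apply: continuous_mx => i j v.
    rewrite /continuous_at mxE; under eq_fun do rewrite mxE.
    (* A basic neighbourhood that constrains a single entry. *)
    move=> P Pv; exists (fun _ k => if k == mxvec_index i j then P else setT).
      move=> i' k; rewrite ord1; case: eqP => [->//|_]; exact: filterT.
    by move=> w /(_ ord0 (mxvec_index i j)); rewrite eqxx.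
  by apply: rV_compact => k; exact: cA.
apply/seteqP; split => [M AM|_ [v Bv <-] i j] /=.
  exists (mxvec M); last exact: mxvecK.
  by move=> /= k; case/mxvec_indexP: k => i j; rewrite mxvecE BE; exact: AM.
by rewrite mxE -BE; exact: Bv.
Qed.

(** * Closure properties of continuous real functions *)

Section RealContinuity.
Variables (R : realType) (T : topologicalType).
Implicit Types F G : T -> R.

Lemma continuous_add F G :
  continuous F -> continuous G -> continuous (fun t => F t + G t).
Proof. by move=> cF cG t; apply: cvgD; [exact: cF|exact: cG]. Qed.

Lemma continuous_sub F G :
  continuous F -> continuous G -> continuous (fun t => F t - G t).
Proof. by move=> cF cG t; apply: cvgB; [exact: cF|exact: cG]. Qed.

Lemma continuous_mul F G :
  continuous F -> continuous G -> continuous (fun t => F t * G t).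
Proof. by move=> cF cG t; apply: cvgM; [exact: cF|exact: cG]. Qed.

Lemma continuous_div F G : (forall t, G t != 0) ->
  continuous F -> continuous G -> continuous (fun t => F t / G t).
Proof.
move=> G0 cF cG; apply: continuous_mul => // t.
by apply: cvgV; [exact: G0|exact: cG].
Qed.

Lemma continuous_sqr F : continuous F -> continuous (fun t => F t ^+ 2).
Proof. by move=> cF; apply: continuous_mul. Qed.

Lemma continuous_sqrt F : continuous F -> continuous (fun t => Num.sqrt (F t)).
Proof.
by move=> cF t; apply: continuous_comp; [exact: cF|exact: sqrt_continuous].
Qed.

Lemma continuous_normr F : continuous F -> continuous (fun t => `|F t|).
Proof. by move=> cF t; apply: cvg_norm; exact: cF. Qed.

Lemma continuous_sum (I : Type) (r : seq I) (F : I -> T -> R) :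
  (forall i, continuous (F i)) -> continuous (fun t => \sum_(i <- r) F i t).
Proof.
by move=> cF; apply: continuous_big => [|i _]; [exact: add_continuous|exact: cF].
Qed.

(** Unlike in [continuous_big], the initial value of the iteration may vary
    with the argument. *)
Lemma continuous_big_idx (op : R -> R -> R) (I : Type) (r : seq I)
    (F0 : T -> R) (F : I -> T -> R) :
  continuous (fun x : R * R => op x.1 x.2) ->
  continuous F0 -> (forall i, continuous (F i)) ->
  continuous (fun t => \big[op/F0 t]_(i <- r) F i t).
Proof.
move=> cop cF0 cF; elim: r => [|i r IHr] t.
  by rewrite /continuous_at big_nil; under eq_cvg do rewrite big_nil; exact: cF0.
rewrite /continuous_at big_cons; under eq_cvg do rewrite big_cons.
apply: (@continuous2_cvg _ _ _ _ _ _ (F i) _ op _ _ (cop (F i t, _))).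
  exact: cF.
exact: IHr.
Qed.

End RealContinuity.

(** * Continuity of the energy *)

Section EnergyContinuity.
Variables (R : realType) (m : nat).
Implicit Types (u f : 'M[R]_m) (i j : 'I_m).

Let cst (a : R) : continuous (fun=> a : R) := @cst_continuous 'M[R]_m R a.

Let entry i j : continuous (fun u : 'M[R]_m => u i j) :=
  @coord_continuous R m m i j.

(* Proves the continuity of an expression in the entries of [u]; only the
   nonvanishing of the denominators is left as a goal. *)
Ltac cont := lazymatch goal with |- forall x, @continuous_at _ _ x ?E =>
  lazymatch E with
  | (fun u : ?V => @Algebra.add _ (@?F u) (@Algebra.opp _ (@?G u))) =>
      apply: continuous_sub; cont
  | (fun u : ?V => @Algebra.add _ (@?F u) (@?G u)) => apply: continuous_add; cont
  | (fun u : ?V => @GRing.exp _ (@?F u) 2%N) => apply: continuous_sqr; cont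
  | (fun u : ?V => @GRing.mul _ (@?F u) (@GRing.inv _ (@?G u))) =>
      apply: continuous_div; [ | cont | cont]
  | (fun u : ?V => @GRing.mul _ (@?F u) (@?G u)) => apply: continuous_mul; cont
  | (fun u : ?V => @Num.sqrt _ (@?F u)) => apply: continuous_sqrt; cont
  | (fun u : ?V => @fun_of_matrix _ _ _ _ _ _) => exact: entry
  | _ => exact: cst
  end end.

Lemma continuous_nbr i j l : continuous (fun u => nbr u i j l).
Proof. by do 9?[case: l => [|l]]; rewrite /nbr /=; cont. Qed.

Lemma continuous_sdist i j l : continuous (fun u => sdist u i j l).
Proof.
have pos (x y : R) : Num.sqrt (x ^+ 2 + y ^+ 2 + 4) != 0.
  by rewrite sqrtr_eq0 -ltNge ltr_wpDl ?addr_ge0 ?sqr_ge0.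
by do 9?[case: l => [|l]]; rewrite /sdist /=; cont.
Qed.

Variable h : R.
Hypothesis h0 : h != 0.

Lemma continuous_ncurv i j l : continuous (fun u => ncurv h u i j l).
Proof.
have h2 : 0 < h ^+ 2 by rewrite exprn_even_gt0.
have pos (x : R) : x ^+ 2 + (if (l <= 4)%N then h ^+ 2 else 2 * h ^+ 2) != 0.
  by rewrite gt_eqF// ltr_wpDl ?sqr_ge0//; case: ifP => _ //; rewrite mulr_gt0.
apply: continuous_div => //.
  by apply: continuous_mul; [exact: cst|exact: continuous_sdist].
apply: continuous_add; last exact: cst.
by apply: continuous_sqr; apply: continuous_sub;
  [exact: continuous_nbr|exact: entry].
Qed.

Lemma continuous_kappa1 i j : continuous (fun u => kappa1 h u i j).
Proof.
by apply: continuous_big_idx => [|| l]; [exact: max_continuous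
  |exact: continuous_ncurv|exact: continuous_ncurv].
Qed.

Lemma continuous_kappa2 i j : continuous (fun u => kappa2 h u i j).
Proof.
by apply: continuous_big_idx => [|| l]; [exact: min_continuous
  |exact: continuous_ncurv|exact: continuous_ncurv].
Qed.

Lemma continuous_mean_curv i j : continuous (fun u => mean_curv h u i j).
Proof.
apply: continuous_mul; last exact: cst.
by apply: continuous_add; [exact: continuous_kappa1|exact: continuous_kappa2].
Qed.

Lemma continuous_gauss_curv i j : continuous (fun u => gauss_curv h u i j).
Proof.
by apply: continuous_mul; [exact: continuous_kappa1|exact: continuous_kappa2].
Qed.

Lemma continuous_energy (g : R -> R) (kappa : 'M[R]_m -> 'I_m -> 'I_m -> R)
    (lambda : R) f :
  continuous g -> (forall i j, continuous (fun u => kappa u i j)) ->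
  continuous (energy g kappa lambda f).
Proof.
move=> cg ck; apply: continuous_add.
  apply: continuous_sum => i; apply: continuous_sum => j.
  apply: continuous_mul; last by rewrite /enorm /grad /=; cont.
  by move=> u; apply: continuous_comp; [exact: ck|exact: cg].
apply: continuous_mul; first exact: cst.
apply: continuous_sum => i; apply: continuous_sum => j; apply: continuous_sqr.
have -> : (fun u => (u - f) i j) = (fun u => u i j - f i j).
  by apply/funext => u; rewrite !mxE.
by apply: continuous_sub; [exact: entry|exact: cst].
Qed.

End EnergyContinuity.

Section WeightContinuity.
Variables (R : realType) (alpha : R).

Lemma continuous_g1 : continuous (g1 alpha).
Proof.
apply: continuous_add; first exact: cst_continuous.
apply: continuous_mul; first exact: cst_continuous.
by apply: continuous_normr => x; exact: cvg_id.
Qed.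

Lemma continuous_g2 : continuous (g2 alpha).
Proof.
apply: continuous_add; first exact: cst_continuous.
apply: continuous_mul; first exact: cst_continuous.
by apply: continuous_normr; apply: continuous_sqr => x; exact: cvg_id.
Qed.

Lemma continuous_g3 : continuous (g3 alpha).
Proof. by apply: continuous_sqrt; exact: continuous_g2. Qed.

End WeightContinuity.

(** * Coercivity and existence *)

Section Existence.
Variables (R : realType) (m : nat).
Variables (g : R -> R) (kappa : 'M[R]_m -> 'I_m -> 'I_m -> R).
Variables (lambda : R) (f : 'M[R]_m).
Hypotheses (g_ge0 : forall k, 0 <= g k) (lambda_gt0 : 0 < lambda).

Lemma sqr_entry_le_normsq (u : 'M[R]_m) i j : u i j ^+ 2 <= normsq u.
Proof.
rewrite /normsq (bigD1 i)//= (bigD1 j)//= -addrA lerDl addr_ge0//.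
  by apply: sumr_ge0 => k _; exact: sqr_ge0.
by apply: sumr_ge0 => k _; apply: sumr_ge0 => l _; exact: sqr_ge0.
Qed.

Lemma fidelity_le_energy u :
  lambda / 2 * normsq (u - f) <= energy g kappa lambda f u.
Proof.
rewrite lerDr; apply: sumr_ge0 => i _; apply: sumr_ge0 => j _.
by rewrite mulr_ge0// sqrtr_ge0.
Qed.

(** Coercivity: the sublevel sets of the energy are bounded. *)
Lemma energy_sublevel (c : R) u i j : energy g kappa lambda f u <= c ->
  `|u i j - f i j| <= Num.sqrt (2 * c / lambda).
Proof.
move=> uc; rewrite -sqrtr_sqr ler_wsqrtr// ler_pdivlMr//.
have -> : u i j - f i j = (u - f) i j by rewrite !mxE.
rewrite mulrC -ler_pdivrMl// mulrA (mulrC 2^-1).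
apply: le_trans uc; apply: le_trans (fidelity_le_energy u).
by rewrite ler_pM2l ?divr_gt0// sqr_entry_le_normsq.
Qed.

Lemma continuous_energy_minimizer : continuous (energy g kappa lambda f) ->
  exists ustar, forall u,
    energy g kappa lambda f ustar <= energy g kappa lambda f u.
Proof.
move=> cE; set E := energy g kappa lambda f in cE *.
(* [r] bounds the entries of [u - f] when [E u <= E f]. *)
pose r := Num.sqrt (2 * E f / lambda).
pose box := [set u : 'M[R]_m |
  forall i j, `[f i j - r, f i j + r]%classic (u i j)]%classic.
have boxE u : E u <= E f -> box u.
  by move=> uf i j /=; rewrite in_itv/= -ler_distl energy_sublevel.
have boxf : box f by exact: boxE.
have cbox : compact box.
  apply: (@mx_compact R m m (fun i j => `[f i j - r, f i j + r]%classic)) => i j.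
  exact: segment_compact.
have [|c _ cmin] := @compact_EVT_min _ _ E _ (ex_intro _ f boxf) cbox.
  exact: continuous_subspaceT.
exists c => u; have [/boxE bu|/ltW] := leP (E u) (E f).
  by apply: cmin; rewrite inE.
by apply: le_trans; apply: cmin; rewrite inE.
Qed.

End Existence.

Theorem lemma3p1 (R : realType) (m : nat) (f : 'M[R]_m) (lambda alpha h : R)
  (g : R -> R) (kappa : 'M[R]_m -> 'I_m -> 'I_m -> R)
  (m_gt0 : (0 < m)%N)
  (lambda_gt0 : 0 < lambda) (alpha_gt0 : 0 < alpha) (h_gt0 : 0 < h)
  (hg : g = g1 alpha \/ g = g2 alpha \/ g = g3 alpha)
  (hkappa : kappa = mean_curv h \/ kappa = gauss_curv h) :
  exists ustar : 'M[R]_m, forall u : 'M[R]_m,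
    energy g kappa lambda f ustar <= energy g kappa lambda f u.
Proof.
have h0 : h != 0 by rewrite gt_eqF.
have g_ge0 k : 0 <= g k.
  by case: hg => [|[|]] ->; rewrite ?sqrtr_ge0// addr_ge0// mulr_ge0// ltW.
apply: continuous_energy_minimizer => //.
apply: continuous_energy => [|i j].
  case: hg => [|[|]] ->.
  - exact: continuous_g1.
  - exact: continuous_g2.
  - exact: continuous_g3.
case: hkappa => ->; first exact: continuous_mean_curv.
exact: continuous_gauss_curv.
Qed.
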